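(* For any clone $\mathcal{C}\subseteq\Omega$ of Boolean functions, the set $\mathbf{I}(\mathcal{C})=\{\mathcal{K}\in\mathbf{I}:[\mathcal{K}]=\mathcal{C}\}$ is an interval in the lattice $(\mathbf{I};\subseteq)$. If $\mathbf{I}(\mathcal{C})$ has more than one element, then $\mathcal{C}_{=}$ is its only coatom.
   Context: $\Omega$ is the set of all Boolean functions $f\colon\{0,1\}^n\to\{0,1\}$, $n\ge 1$. An $m$-ary $g$ is a subfunction of an $n$-ary $f$ if there is a map $\sigma\colon\{1,\dots,n\}\to\{1,\dots,m\}$ with $g(x_1,\dots,x_m)=f(x_{\sigma(1)},\dots,x_{\sigma(n)})$ identically. An equational class is a set $\mathcal{K}\subseteq\Omega$ (possibly empty) such that every subfunction of a member of $\mathcal{K}$ is in $\mathcal{K}$. For an $n$-ary $f$ and $k$-ary $g_1,\dots,g_n$, the composition $f(g_1,\dots,g_n)$ is the $k$-ary function $\mathbf{a}\mapsto f(g_1(\mathbf{a}),\dots,g_n(\mathbf{a}))$. For $\mathcal{A},\mathcal{B}\subseteq\Omega$, $\mathcal{A}\circ\mathcal{B}$ is the set of all compositions $f(g_1,\dots,g_n)$ with $f\in\mathcal{A}$ and $g_1,\dots,g_n\in\mathcal{B}$ of equal arity. $\mathcal{K}$ is composition-closed if $\mathcal{K}\circ\mathcal{K}\subseteq\mathcal{K}$. A clone is a subset of $\Omega$ that is composition-closed and contains all projections; $[\mathcal{K}]$ is the smallest clone containing $\mathcal{K}$. $\mathbf{I}$ is the set of all composition-closed equational classes of Boolean functions,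 which is a complete lattice under inclusion. $\Omega_{=}=\{f\in\Omega: f(0,\dots,0)=f(1,\dots,1)\}$ and $\mathcal{C}_{=}=\mathcal{C}\cap\Omega_{=}$. An interval is a set of the form $\{\mathcal{K}\in\mathbf{I}:\mathcal{A}\subseteq\mathcal{K}\subseteq\mathcal{B}\}$ with $\mathcal{A}\subseteq\mathcal{B}$ in $\mathbf{I}$; a coatom of it is an element covered by its top element $\mathcal{B}$. *)

(* Defs.v *)
From mathcomp Require Import all_boot.
From mathcomp Require Import boolp classical_sets.

Set Implicit Arguments.
Unset Strict Implicit.
Unset Printing Implicit Defensive.

Local Open Scope classical_set_scope.

(* Arities are positive, so the stored number is the arity minus one.
   Extensionally equal functions are equal by functional extensionality. *)
Definition bfun (n : nat) : Type := ('I_n.+1 -> bool) -> bool.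

Definition Omega : Type := {n : nat & bfun n}.

Definition pack (n : nat) (f : bfun n) : Omega := existT bfun n f.

Definition arity (f : Omega) : nat := (projT1 f).+1.

Definition ev (f : Omega) : ('I_(arity f) -> bool) -> bool := projT2 f.
Arguments ev : clear implicits.

Definition subfunction (g f : Omega) : Prop :=
  exists s : 'I_(arity f) -> 'I_(arity g),
    forall x : 'I_(arity g) -> bool, ev g x = ev f (fun i => x (s i)).

Definition equational_class (K : set Omega) : Prop :=
  forall f g : Omega, K f -> subfunction g f -> K g.

Definition compose (n k : nat) (f : bfun n) (g : 'I_n.+1 -> bfun k) : bfun k :=
  fun a => f (fun i => g i a).

Definition class_comp (A B : set Omega) : set Omega :=
  [set h | exists (n k : nat) (f : bfun n) (g : 'I_n.+1 -> bfun k),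
     [/\ A (pack f), (forall i, B (pack (g i))) & h = pack (compose f g)]].

Definition composition_closed (K : set Omega) : Prop := class_comp K K `<=` K.

Definition projection (n : nat) (i : 'I_n.+1) : bfun n := fun x => x i.

Definition is_clone (C : set Omega) : Prop :=
  composition_closed C /\ forall (n : nat) (i : 'I_n.+1), C (pack (projection i)).

Definition generated_clone (K : set Omega) : set Omega := smallest is_clone K.

(* The empty class is a member. *)
Definition ccec : set (set Omega) :=
  [set K | equational_class K /\ composition_closed K].

Definition ccec_of (C : set Omega) : set (set Omega) :=
  [set K | ccec K /\ generated_clone K = C].

Definition Omega_eq : set Omega :=
  [set f | ev f (fun=> false) = ev f (fun=> true)].

Definition interval (A B : set Omega) : set (set Omega) :=
  [set K | [/\ ccec K, A `<=` K & K `<=` B]].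

Definition covered_by (K L : set Omega) : Prop :=
  [/\ ccec K, ccec L, K `<` L &
      forall M : set Omega, ccec M -> ~ (K `<` M /\ M `<` L)].

Definition coatoms (A B : set Omega) : set (set Omega) :=
  [set K | interval A B K /\ covered_by K B].

(* Main.v *)
Require Import Defs.
From mathcomp Require Import all_boot.
From mathcomp Require Import boolp classical_sets.

Local Open Scope classical_set_scope.

(** Write [K] for the clone generated by a class K.  The top of the interval is
C itself, and the bottom is the intersection A of all K in I(C); all the work
lies in proving [A] = C.

The members of I(C) other than C satisfy f(0) = f(1) throughout: a function
violating this yields the identity, by identifying variables and possibly
composing the resulting negation with itself, and a composition-closed
equational class containing the identity is already a clone
([ccec_of_proper_Omega_eq]).  This gives the statement on coatoms as soon as
I(C) is an interval, because the members of C with f(0) = f(1) form a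
composition-closed equational class.

A class K in I(C) absorbs C from the left: C o K is contained in K, since the
functions g with g o K contained in K form a clone that contains K
([left_absorption]).  Two cases remain for the proof that [A] = C.

If every member of C with f(0) = f(1) is constant, then K together with the
projections is a clone for every K in I(C) distinct from C, so that K is equal
to the set of these constants, and I(C) has at most one member besides C.

Otherwise every K in I(C) contains one of x + y, x + y + 1 (modulo 2), x and
not y, x or not y: these are the functions [tilt c d].  They
can be compared: using left absorption, a tilt in C can be recovered from
any tilt in K as long as the symmetric ones are preferred to the others
whenever C contains one ([tilt_transfer]).  So one tilt h lies in all members of
I(C), hence in A.  Finally h(x, h(y, y)) = x.  For g in C the function
g(h(x_1, y), ..., h(x_n, y)) belongs to A by left absorption, and replacing y
by the constant h(y, y) recovers g inside [A] ([tilt_generates]). *)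

(** * Clones and composition-closed equational classes *)

Lemma clone_comp (C : set Omega) n k (f : bfun n) (g : 'I_n.+1 -> bfun k) :
  is_clone C -> C (pack f) -> (forall i, C (pack (g i))) ->
  C (pack (compose f g)).
Proof. by move=> [CC _] Cf Cg; apply: CC; exists n, k, f, g. Qed.

Lemma ccec_comp (K : set Omega) n k (f : bfun n) (g : 'I_n.+1 -> bfun k) :
  ccec K -> K (pack f) -> (forall i, K (pack (g i))) -> K (pack (compose f g)).
Proof. by move=> [_ KK] Kf Kg; apply: KK; exists n, k, f, g. Qed.

Lemma ccec_subst (K : set Omega) n k (f : bfun n) (s : 'I_n.+1 -> 'I_k.+1) :
  ccec K -> K (pack f) -> K (pack (fun x : 'I_k.+1 -> bool => f (x \o s))).
Proof. by move=> [Keq _] Kf; apply: (Keq _ _ Kf); exists s. Qed.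

Lemma clone_ccec (C : set Omega) : is_clone C -> ccec C.
Proof.
move=> hC; split; last by case: hC.
move=> [n f] [k g] Cf [s /= fg].
have -> : existT bfun k g = pack (compose f (fun i => projection (s i))).
  by congr existT; apply: funext => x; apply: fg.
by apply: clone_comp => // i; apply: hC.2.
Qed.

Lemma sub_generated_clone (K : set Omega) : K `<=` generated_clone K.
Proof. exact: sub_gen_smallest. Qed.

Lemma generated_clone_sub (K C : set Omega) :
  is_clone C -> K `<=` C -> generated_clone K `<=` C.
Proof. exact: smallest_sub. Qed.

Lemma generated_clone_clone (K : set Omega) : is_clone (generated_clone K).
Proof.
split; last by move=> n i D [[_ Dproj] _]; apply: Dproj.
move=> _ [n [k [f [g [Kf Kg ->]]]]] D [Dclone KD].
by apply: clone_comp => //; [apply: Kf | move=> i; apply: Kg].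
Qed.

Lemma generated_clone_id (C : set Omega) : is_clone C -> generated_clone C = C.
Proof. exact: smallest_id. Qed.

Lemma generated_clone_mono (K L : set Omega) :
  K `<=` L -> generated_clone K `<=` generated_clone L.
Proof.
move=> KL; apply: generated_clone_sub; first exact: generated_clone_clone.
exact: subset_trans KL (@sub_generated_clone L).
Qed.

Lemma ccec_of_between (C A K : set Omega) :
  is_clone C -> generated_clone A = C -> interval A C K -> ccec_of C K.
Proof.
move=> hC AC [cK AK KC]; split=> //; apply/seteqP; split.
  exact: generated_clone_sub.
by rewrite -{1}AC; apply: generated_clone_mono.
Qed.

Lemma ccec_of_sub (C K : set Omega) : ccec_of C K -> K `<=` C.
Proof. by move=> [_ <-]; apply: sub_generated_clone. Qed.

Lemma ccec_bigcap (F : set (set Omega)) :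
  F `<=` ccec -> ccec (\bigcap_(K in F) K).
Proof.
move=> Fccec; split.
  by move=> f g Ff gf K FK; case: (Fccec K FK) => Keq _; apply: (Keq f) => //;
     apply: Ff.
move=> _ [n [k [f [g [Kf Kg ->]]]]] K FK.
by apply: ccec_comp; [apply: Fccec | apply: Kf | move=> i; apply: Kg].
Qed.

(** The functions that map tuples of K into K form a clone, and K lies in it by
composition closure. *)
Lemma left_absorption (K : set Omega) :
  ccec K -> class_comp (generated_clone K) K `<=` K.
Proof.
move=> cK.
pose D : set Omega := [set g | forall k (u : 'I_(arity g) -> bfun k),
  (forall i, K (pack (u i))) -> K (pack (compose (projT2 g) u))].
have Dclone : is_clone D.
  split; last by move=> n i k u Ku; apply: Ku.
  move=> _ [n [k [f [g [Df Dg ->]]]]] l u Ku /=.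
  by apply: (Df l (fun i => compose (g i) u)) => i; apply: Dg.
have KD : K `<=` D by move=> [n f] Kf k u Ku; apply: ccec_comp.
move=> _ [n [k [f [u [Cf Ku ->]]]]].
exact: (generated_clone_sub _ _ Dclone KD _ Cf k u).
Qed.

(** * Functions with equal values at the two constant tuples *)

Lemma ccec_clone (K : set Omega) :
  ccec K -> K (pack (projection (@ord0 0))) -> is_clone K.
Proof.
move=> cK Kid; split; first by case: cK.
by move=> n i; apply: (ccec_subst _ _ _ _ (fun=> i) cK Kid).
Qed.

Lemma ccec_nonOmega_eq_clone (K : set Omega) (f : Omega) :
  ccec K -> K f -> ~ Omega_eq f -> is_clone K.
Proof.
case: f => n f cK Kf /eqP; rewrite /ev /= => f01.
apply: ccec_clone => //.
pose u : bfun 0 := fun x => f (fun=> x ord0).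
have Ku : K (pack u) by apply: (ccec_subst _ _ _ _ (fun=> ord0) cK Kf).
have uE x : u x = if x ord0 then f (fun=> true) else f (fun=> false).
  by rewrite /u; case: (x ord0).
case f0: (f (fun=> false)) f01 uE; case f1: (f (fun=> true)) => // _ uE.
  (* here u is the negation *)
  have -> : projection (@ord0 0) = compose u (fun=> u).
    by apply: funext => x; rewrite /compose /projection !uE; case: (x ord0).
  by apply: ccec_comp.
have -> // : projection (@ord0 0) = u.
by apply: funext => x; rewrite /projection uE; case: (x ord0).
Qed.

Lemma ccec_of_proper_Omega_eq (C K : set Omega) :
  ccec_of C K -> K <> C -> K `<=` C `&` Omega_eq.
Proof.
move=> [cK KC] nKC f Kf; split; first by rewrite -KC; apply: sub_generated_clone.
apply: contrapT => nf; apply: nKC; rewrite -KC generated_clone_id //.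
exact: ccec_nonOmega_eq_clone Kf nf.
Qed.

Lemma ccec_setI_Omega_eq (C : set Omega) : ccec C -> ccec (C `&` Omega_eq).
Proof.
move=> cC; split.
  move=> f g [Cf f01] gf; split; first exact: (cC.1 _ _ Cf gf).
  by case: gf => s gE; rewrite /Omega_eq /= !gE.
move=> _ [n [k [f [g [[Cf f01] Cg ->]]]]]; split.
  by apply: ccec_comp => // i; case: (Cg i).
rewrite /Omega_eq /ev /= /compose; congr f; apply: funext => i.
by case: (Cg i).
Qed.

Lemma projection_not_Omega_eq n (i : 'I_n.+1) :
  ~ Omega_eq (pack (projection i)).
Proof. by []. Qed.

(** * Classes of constant functions *)

Definition constant_fun (f : Omega) : Prop := forall x y, ev f x = ev f y.

(** Adding the projections to K already produces a clone, because substituting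
into a constant only changes its arity. *)
Lemma constant_class_Omega_eq (K : set Omega) :
  ccec K -> K `<=` constant_fun -> generated_clone K `&` Omega_eq `<=` K.
Proof.
move=> cK Kconst.
pose D : set Omega := K `|` [set f | exists i, forall x, ev f x = x i].
have Dclone : is_clone D.
  split; last by move=> n i; right; exists i.
  move=> _ [n [k [f [g [Df Dg ->]]]]].
  case: Df => [Kf|[i fE]].
    left; have -> : compose f g = fun x => f (x \o (fun=> ord0)).
      by apply: funext => x; apply: (Kconst _ Kf).
    exact: (ccec_subst _ _ _ _ (fun=> ord0) cK Kf).
  have -> // : compose f g = g i.
  by apply: funext => x; apply: fE.
move=> f [Kf f01].
have [//|[i fE]] := generated_clone_sub _ _ Dclone (@subsetUl _ _ _) _ Kf.
by move: f01; rewrite /Omega_eq /= !fE.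
Qed.

(** * The binary functions [tilt] *)

(** These are the non-constant binary operations with equal values at (0, 0) and
(1, 1), up to exchanging the variables.  Choosing x or not y, rather than y or
not x, in the case c = 1 and d = 0 makes the operations for c = 1 dual to those
for c = 0, and gives [tilt_opK]. *)
Definition tilt_op (c d x y : bool) : bool :=
  if d then c (+) (x (+) y) else if c then x || ~~ y else x && ~~ y.

Definition tilt (c d : bool) : bfun 1 :=
  fun x => tilt_op c d (x ord0) (x ord_max).

Lemma tilt_opK c d x y : tilt_op c d x (tilt_op c d y y) = x.
Proof. by case: c d x y => [] [] [] []. Qed.

Definition pair_fun k (u v : bfun k) : 'I_2 -> bfun k :=
  fun i => if i == ord0 then u else v.

Lemma compose_tilt c d k (u v : bfun k) x :
  compose (tilt c d) (pair_fun k u v) x = tilt_op c d (u x) (v x).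
Proof. by []. Qed.

(** Identify the variables of f according to a point where f differs from its
value on the constant tuples. *)
Lemma nonconstant_tilt (K : set Omega) (f : Omega) :
  ccec K -> K f -> Omega_eq f -> ~ constant_fun f ->
  exists c d, K (pack (tilt c d)).
Proof.
case: f => n f cK Kf; rewrite /Omega_eq /constant_fun /ev /= => f01 nf.
have [a fa] : exists a, f a <> f (fun=> false).
  apply: contrapT => /forallNP fc; apply: nf => x y.
  by rewrite (contrapT (fc x)) (contrapT (fc y)).
(* a is sent to (1, 0) if f(0) = 0, and to (0, 1) if f(0) = 1: these are the
   points where both x + y + f(0) and x and not y, respectively x or not y,
   take the value 1 + f(0) *)
pose p i := a i (+) f (fun=> false).
pose s (i : 'I_n.+1) : 'I_2 := if p i then ord0 else ord_max.
exists (f (fun=> false)), (f (fun=> false) (+) f (fun i => ~~ a i)).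
suff <- : (fun x : 'I_2 -> bool => f (x \o s)) =
    tilt (f (fun=> false)) (f (fun=> false) (+) f (fun i => ~~ a i)).
  exact: (ccec_subst _ _ _ _ s cK Kf).
apply: funext => x.
have -> : x \o s = fun i => if p i then x ord0 else x ord_max.
  by apply: funext => i; rewrite /s /=; case: (p i).
have f_eq b : f (fun=> b) = f (fun=> false) by case: b; rewrite ?f01.
have [xE|xE] := eqVneq (x ord0) (x ord_max).
  have -> : (fun i => if p i then x ord0 else x ord_max) = fun=> x ord0.
    by apply: funext => i; rewrite xE if_same.
  rewrite f_eq /tilt /tilt_op xE.
  by case: (f (fun=> false)); case: (f _); case: (x _).
have -> : (fun i => if p i then x ord0 else x ord_max) =
    fun i => a i (+) (f (fun=> false) (+) x ord_max).
  apply: funext => i; rewrite /p; move: xE.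
  by case: (x ord0); case: (x ord_max); case: (a i); case: (f _).
have fa' : f a = ~~ f (fun=> false).
  by move/eqP: fa; case: (f a); case: (f _).
have [bE|bE] := boolP (f (fun=> false) (+) x ord_max).
  have -> : (fun i => a i (+) true) = fun i => ~~ a i.
    by apply: funext => i; rewrite addbT.
  rewrite /tilt /tilt_op; move: bE xE.
  by case: (x ord0); case: (x ord_max); case: (f (fun=> false)); case: (f _).
have -> : (fun i => a i (+) false) = a by apply: funext => i; rewrite addbF.
rewrite fa' /tilt /tilt_op; move: bE xE.
by case: (x ord0); case: (x ord_max); case: (f (fun=> false)); case: (f _).
Qed.

(** Put h' = [tilt c' d'].  If h' is not symmetric, then x + y is the sum of
h'(x, y) and h'(y, x), and x and not y is the conjunction of h'(x, y) with the
negation of h'(y, x); both are obtained by left absorption, and dually.  The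
condition on d and d' is necessary: among the functions with f(0) = 0, those
invariant under complementing all the arguments form a class that generates x
and not y and contains x + y, but not x and not y. *)
Lemma tilt_transfer (C K : set Omega) c d c' d' :
  ccec_of C K -> C (pack (tilt c d)) -> K (pack (tilt c' d')) ->
  (d' ==> d) -> K (pack (tilt c d)).
Proof.
move=> [cK <-] Ch Kh dd.
have Kpair (t : 'I_2 -> 'I_2) : K (pack (compose (tilt c d)
    (pair_fun 1 (tilt c' d') (fun x => tilt c' d' (x \o t))))).
  apply: left_absorption => //; do 4!eexists; split; [exact: Ch | | by []].
  move=> i; rewrite /pair_fun; case: ifP => // _.
  exact: (ccec_subst _ _ _ _ t cK Kh).
pose swap (i : 'I_2) : 'I_2 := if i == ord0 then ord_max else ord0.
(* for d' = 1, hence d = 1, h' only has to be adjusted by its constant h'(x, x) *)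
pose t : 'I_2 -> 'I_2 := if d' then fun=> ord0 else swap.
suff -> : tilt c d = compose (tilt c d)
    (pair_fun 1 (tilt c' d') (fun x => tilt c' d' (x \o t))).
  exact: Kpair.
apply: funext => x; rewrite compose_tilt /tilt /tilt_op /t /swap.
by case: d' d dd c' c {Ch Kh Kpair t} => [] [] // _ [] [] /=;
   case: (x ord0); case: (x ord_max).
Qed.

(** By [tilt_opK], h(x, h(y, y)) = x for h = [tilt c d].  Hence a function g of C
is obtained from g(h(x_1, y), ..., h(x_n, y)), which lies in A, by substituting
the constant h(y, y) for y. *)
Lemma tilt_generates (C A : set Omega) c d :
  is_clone C -> ccec A -> A `<=` C -> class_comp C A `<=` A ->
  A (pack (tilt c d)) -> generated_clone A = C.
Proof.
move=> hC cA AC CA Ah; apply/seteqP; split; first exact: generated_clone_sub.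
move=> [n g] Cg.
have gclone := generated_clone_clone A.
pose u (i : 'I_n.+1) : bfun n.+1 :=
  fun x => tilt c d (x \o (fun j => if j == ord0 then lift ord0 i else ord0)).
have Agu : A (pack (compose g u)).
  apply: CA; exists n, n.+1, g, u; split=> // i.
  exact: (ccec_subst _ _ _ _ (fun j => if j == ord0 then lift ord0 i else ord0)).
have Ac : A (pack (fun x : 'I_n.+1 -> bool => tilt c d (x \o (fun=> ord0)))).
  exact: (ccec_subst _ _ _ _ (fun=> ord0)).
pose v (j : 'I_n.+2) : bfun n :=
  if unlift ord0 j is Some i then projection i
  else fun x => tilt c d (x \o (fun=> ord0)).
have -> : existT bfun n g = pack (compose (compose g u) v).
  congr existT; apply: funext => x; rewrite /compose; congr g.
  apply: funext => i; rewrite /u /tilt /v /= liftK unlift_none.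
  by rewrite /projection /tilt tilt_opK.
apply: clone_comp => //; first exact: sub_generated_clone.
move=> j; rewrite /v; case: unlift => [i|]; first exact: gclone.2.
exact: sub_generated_clone.
Qed.

(** * The interval *)

Lemma meet_generates (C : set Omega) :
  is_clone C -> generated_clone (\bigcap_(K in ccec_of C) K) = C.
Proof.
move=> hC; set A := \bigcap_(K in _) K.
have CC : ccec_of C C by split; [exact: clone_ccec | exact: generated_clone_id].
have AC : A `<=` C by move=> f; apply.
have cA : ccec A by apply: ccec_bigcap => K [].
have [only|/existsNP[K0 /not_implyP[CK0 nK0]]] :=
    pselect (forall K, ccec_of C K -> K = C).
  suff -> : A = C by exact: generated_clone_id.
  by apply/seteqP; split=> // f Cf K /only ->.
have small K : ccec_of C K -> K `<=` constant_fun -> C `&` Omega_eq `<=` K.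
  by move=> [cK <-]; apply: constant_class_Omega_eq.
have [const|nconst] := pselect (C `&` Omega_eq `<=` constant_fun).
  suff K0A : K0 `<=` A.
    apply/seteqP; split; first exact: generated_clone_sub.
    by rewrite -{1}CK0.2; apply: generated_clone_mono.
  apply: subset_trans (ccec_of_proper_Omega_eq _ _ CK0 nK0) _ => f fC K CK.
  have [->|nKC] := pselect (K = C); first by case: fC.
  apply: small fC => //.
  exact: subset_trans (ccec_of_proper_Omega_eq _ _ CK nKC) const.
have hastilt K : ccec_of C K -> exists c d, K (pack (tilt c d)).
  move=> CK; have [f [Kf f01 nf]] :
      exists f, [/\ K f, Omega_eq f & ~ constant_fun f].
    apply: contrapT => /forallNP nK; apply: nconst.
    have [KC|nKC] := pselect (K = C).
      move=> f [Cf f01]; apply: contrapT => nf; apply: (nK f).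
      by split=> //; rewrite KC.
    have KE := ccec_of_proper_Omega_eq _ _ CK nKC.
    have Kconst : K `<=` constant_fun.
      move=> f Kf; apply: contrapT => nf; apply: (nK f); split=> //.
      by case: (KE f Kf).
    exact: subset_trans (small K CK Kconst) Kconst.
  by apply: nonconstant_tilt Kf f01 nf; case: CK.
(* d is chosen to be 1 whenever C allows it, so that [tilt_transfer] applies
   to every tilt in C *)
have [c [d [Ch dmax]]] : exists c d, C (pack (tilt c d)) /\
    forall c' d', C (pack (tilt c' d')) -> d' ==> d.
  have [[c Cc]|nC] := pselect (exists c, C (pack (tilt c true))).
    by exists c, true; split=> // c' d' _; rewrite implybT.
  have [c [[] Cc]] := hastilt C CC; first by case: nC; exists c.
  by exists c, false; split=> // c' [] // Cc'; case: nC; exists c'.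
apply: (@tilt_generates C A c d) => //.
  move=> _ [n [k [f [g [Cf Ag ->]]]]] K [cK KC].
  apply: left_absorption => //; exists n, k, f, g; split=> //.
    by rewrite KC.
  by move=> i; apply: (Ag i).
move=> K CK; have [c' [d' Kh]] := hastilt K CK.
apply: (tilt_transfer _ _ _ _ _ _ CK Ch Kh).
by apply: (dmax c'); apply: (ccec_of_sub _ _ CK).
Qed.

Theorem theorem3p9 (C : set Omega) (hC : is_clone C) :
  exists A B : set Omega,
    [/\ ccec A, ccec B, A `<=` B, ccec_of C = interval A B &
        (exists K L : set Omega, [/\ ccec_of C K, ccec_of C L & K <> L]) ->
        coatoms A B = [set C `&` Omega_eq]].
Proof.
have cC := clone_ccec _ hC; have Agen := meet_generates _ hC.
have CC : ccec_of C C by split=> //; exact: generated_clone_id.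
exists (\bigcap_(K in ccec_of C) K), C.
set A := \bigcap_(K in _) K in Agen *.
have AK K : ccec_of C K -> A `<=` K by move=> CK f; apply.
have between K : interval A C K -> ccec_of C K by exact: ccec_of_between.
split=> //; first by apply: ccec_bigcap => K [].
- exact: AK.
- apply/seteqP; split=> K; last exact: between.
  by move=> CK; split; [case: CK | exact: AK | exact: ccec_of_sub].
move=> [K [L [CK CL KL]]].
have [M CM nMC] : exists2 M, ccec_of C M & M <> C.
  have [KC|nKC] := pselect (K = C); last by exists K.
  by exists L => // LC; apply: KL; rewrite KC LC.
have AE : A `<=` C `&` Omega_eq.
  exact: subset_trans (AK _ CM) (ccec_of_proper_Omega_eq _ _ CM nMC).
have cE := ccec_setI_Omega_eq _ cC.
have EC : C `&` Omega_eq `<` C.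
  split; first by move=> f [].
  move=> /(_ (pack (projection (@ord0 0)))) [|_]; first exact: hC.2.
  exact: projection_not_Omega_eq.
have below N : ccec N -> A `<=` N -> N `<` C -> N `<=` C `&` Omega_eq.
  move=> cN AN [NC nCN]; apply: ccec_of_proper_Omega_eq.
    by apply: between.
  by move=> NE; apply: nCN; rewrite NE.
apply/seteqP; split=> [N [[cN AN NC] [_ _ ltNC Ncov]]|_ ->] /=.
  have NE := below N cN AN ltNC.
  apply/seteqP; split=> //; apply: contrapT => nEN.
  by apply: (Ncov _ cE); split.
split; first by split=> // f [].
split=> // N cN [[EN nNE] ltNC]; apply: nNE; apply: below => //.
exact: subset_trans AE EN.
Qed.
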